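(* Let $q,a,b$ be nonzero complex numbers with $|q|<1$ and $\max\{|ab/q|,|a|,|b|\}<1$. Then $$\frac{(q,ab/q;q)_\infty}{(a,b;q)_\infty}\;{}_3\phi_2\left(\begin{matrix}q/a,\,q/b,\,q\\ q^{1/2},\,-q^{1/2}\end{matrix};q,ab/q\right)$$ $$=1+\sum_{n=1}^{\infty}(1+q^{n})q^{n^2-2n}\frac{(q/a,q/b;q)_n}{(a,b;q)_n}(-ab)^n\left(q^{-n(n+1)/2}-(1-q^n)\sum_{j=0}^{n}q^{-j(j+1)/2}\right).$$
   Context: Notation: $(x;q)_0=1$, $(x;q)_n=\prod_{k=0}^{n-1}(1-xq^k)$, $(x;q)_\infty=\prod_{k=0}^\infty(1-xq^k)$, $(x_1,\dots,x_k;q)_n=(x_1;q)_n\cdots(x_k;q)_n$ (also for $n=\infty$), and $${}_3\phi_2\left(\begin{matrix}A_1,A_2,A_3\\ B_1,B_2\end{matrix};q,z\right)=\sum_{n=0}^\infty\frac{(A_1,A_2,A_3;q)_n}{(q,B_1,B_2;q)_n}z^n .$$ Here $q^{1/2}$ is a fixed square root of $q$ (the series does not depend on the choice). *)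

(* Defs.v *)
From mathcomp Require Import all_boot all_order all_algebra.
From mathcomp Require Import complex.
From mathcomp Require Import boolp classical_sets reals topology normedtype.
From mathcomp Require Import sequences.

Set Implicit Arguments.
Unset Strict Implicit.
Unset Printing Implicit Defensive.

Import Order.TTheory GRing.Theory Num.Theory.
Import numFieldNormedType.Exports.

Local Open Scope classical_set_scope.
Local Open Scope ring_scope.

(* The type [complex R] seen through its closed field structure, from which the
   norm topology is inferred. *)
Definition Cplx (R : realType) : numClosedFieldType := complex R.

(* Infinite products and series are total limits, with a default value in case
   of divergence; convergence has to be asserted separately. *)
Section QSeries.
Variable C : numFieldType.
Implicit Types (q x z : C) (xs : seq C) (n : nat).

Definition qpoch x q n : C := \prod_(k < n) (1 - x * q ^+ k).

Definition qpoch_oo x q : C := limn (qpoch x q).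

Definition qpochs xs q n : C := \prod_(x <- xs) qpoch x q n.

Definition qpochs_oo xs q : C := \prod_(x <- xs) qpoch_oo x q.

Definition phi32_term (A1 A2 A3 B1 B2 : C) q z n : C :=
  qpochs [:: A1; A2; A3] q n / qpochs [:: q; B1; B2] q n * z ^+ n.

Definition phi32 (A1 A2 A3 B1 B2 : C) q z : C :=
  limn (series (phi32_term A1 A2 A3 B1 B2 q z)).

End QSeries.

(* Main.v *)
(* Put z = ab/q, A = q/a and B = q/b.  The identity is the limit N -> oo of the
   finite form of Bailey's lemma, applied to the Bailey pair relative to 1
     v_n = 1 / (q; q^2)_n,   u_0 = 1,
     u_n = (-1)^n (1 + q^n) q^(n(n-1))
             (q^(-n(n+1)/2) - (1 - q^n) \sum_(j <= n) q^(-j(j+1)/2)).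
   The finite form exchanges two sums and evaluates the inner one by the
   q-Pfaff-Saalschuetz formula.  The pair itself follows by induction on n,
   because the difference between the sum for n + 1, multiplied by
   1 - q^(2n+1), and the sum for n telescopes.  Since u is bounded, both sides
   are dominated by geometric series of ratio |z| < 1, and Tannery's theorem
   allows passing to the limit termwise. *)

Require Import Defs.
From mathcomp Require Import all_boot all_order all_algebra.
From mathcomp Require Import complex ring zify.
From mathcomp Require Import boolp classical_sets reals topology normedtype.
From mathcomp Require Import sequences exp.

Set Implicit Arguments.
Unset Strict Implicit.
Unset Printing Implicit Defensive.

Import Order.TTheory GRing.Theory Num.Theory.
Import numFieldNormedType.Exports.

Local Open Scope classical_set_scope.
Local Open Scope ring_scope.

(** * Shifted factorials of q, triangular exponents and the Bailey sequence *)

Definition qqpoch (C : numFieldType) (q : C) n := qpoch q q n.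

Lemma qpochs2 (C : numFieldType) (x y q : C) n :
  qpochs [:: x; y] q n = qpoch x q n * qpoch y q n.
Proof. by rewrite /qpochs !big_cons big_nil mulr1. Qed.

Lemma qpochs_oo2 (C : numFieldType) (x y q : C) :
  qpochs_oo [:: x; y] q = qpoch_oo x q * qpoch_oo y q.
Proof. by rewrite /qpochs_oo !big_cons big_nil mulr1. Qed.

Definition tri j := ((j * j.+1) %/ 2)%N.

Lemma triS j : tri j.+1 = (tri j + j.+1)%N.
Proof. by rewrite addnC /tri -divnMDl //; congr divn; lia. Qed.

Definition tri_psum (C : numFieldType) (q : C) n :=
  \sum_(0 <= j < n.+1) q ^- tri j.

(** The sequence u of the Bailey pair. Its closed formula would give 2 at n = 0, twice the required
    value, hence the separate case. *)
Definition bailey_alpha (C : numFieldType) (q : C) n : C :=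
  if n is k.+1 then
    (-1) ^+ n * (1 + q ^+ n) * q ^+ (n * k)
    * (q ^- tri n - (1 - q ^+ n) * tri_psum q n)
  else 1.

(** * Finite identities *)

Section FiniteIdentities.
Variables (C : numFieldType) (q : C).
Hypotheses (q_neq0 : q != 0) (q_nroot : forall k, 1 - q ^+ k.+1 != 0).
Implicit Types (x z : C) (n r : nat).

Lemma qpoch0 x : qpoch x q 0 = 1.
Proof. by rewrite /qpoch big_ord0. Qed.

Lemma qpochS x n : qpoch x q n.+1 = qpoch x q n * (1 - x * q ^+ n).
Proof. by rewrite /qpoch big_ord_recr. Qed.

Lemma qpoch_neq0 x n : (forall k, 1 - x * q ^+ k != 0) -> qpoch x q n != 0.
Proof. by move=> xq; apply/prodf_neq0 => i _; apply: xq. Qed.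

Lemma qpochD x m n : qpoch x q (m + n) = qpoch x q m * qpoch (x * q ^+ m) q n.
Proof.
elim: n => [|n IH]; first by rewrite addn0 qpoch0 mulr1.
by rewrite addnS !qpochS IH -!mulrA -exprD.
Qed.

Lemma qpochq_neq0 m n : qpoch (q ^+ m.+1) q n != 0.
Proof. by apply: qpoch_neq0 => k; rewrite -exprD addSn q_nroot. Qed.

Local Notation qq := (qqpoch q).
Local Notation psum := (tri_psum q).
Local Notation alpha := (bailey_alpha q).

Lemma qqpoch_neq0 n : qq n != 0.
Proof. by rewrite /qqpoch -[q in qpoch q]expr1 qpochq_neq0. Qed.

Lemma qqpoch0 : qq 0 = 1. Proof. exact: qpoch0. Qed.

Lemma qqpochS n : qq n.+1 = qq n * (1 - q ^+ n.+1).
Proof. by rewrite /qqpoch qpochS -exprS. Qed.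

(** The q-Pfaff-Saalschuetz sum in convolution form: both sides are the coefficient of t^M in
    Heine's transformation 2phi1(Az, Bz; c; t) = (zt; q)_oo / (t; q)_oo 2phi1(A, B; c; zt). *)
Lemma q_saalschutz A B z (c := A * B * z) M :
    (forall k, 1 - c * q ^+ k != 0) ->
  \sum_(i < M.+1) qpoch A q i * qpoch B q i * qpoch z q (M - i) * z ^+ i
     / (qq i * qq (M - i) * qpoch c q i)
  = qpoch (A * z) q M * qpoch (B * z) q M / (qq M * qpoch c q M).
Proof.
move=> cq; have cN0 := qpoch_neq0 _ cq.
elim: M => [|M IH].
  by rewrite big_ord_recr big_ord0 /= /qqpoch !qpoch0 !add0r !mulr1.
pose F M i := qpoch A q i * qpoch B q i * qpoch z q (M - i) * z ^+ i
  / (qq i * qq (M - i) * qpoch c q i).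
pose Q := q ^+ M.
(* Wilf-Zeilberger: the recurrence in [M], summed against its certificate *)
have telescope m : (m <= M)%N ->
    (1 - q * Q) * (1 - c * Q) * (\sum_(i < m.+1) F M.+1 i)
    - (1 - A * z * Q) * (1 - B * z * Q) * (\sum_(i < m.+1) F M i)
    = - q ^+ (M - m) * (qpoch A q m.+1 * qpoch B q m.+1 * qpoch z q (M - m)
      * z ^+ m.+1) / (qq m * qq (M - m) * qpoch c q m).
  elim: m => [_|m IHm lt_mM].
    rewrite !big_ord_recl !big_ord0 /F /= !subn0 !addr0 !qpochS !qpoch0 qqpochS.
    rewrite exprS -/Q /c; field.
    by rewrite !qqpoch_neq0 -exprS q_nroot.
  rewrite !(big_ord_recr m.+1) /= !(mulrDr _ (\sum_(i < m.+1) _)) opprD addrACA.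
  rewrite IHm; last exact: ltnW.
  rewrite /F; have -> : (M - m = (M - m.+1).+1)%N by lia.
  have -> : (M.+1 - m.+1 = (M - m.+1).+1)%N by lia.
  have QE : Q = q ^+ (M - m.+1) * q ^+ m.+1 by rewrite -exprD subnK.
  rewrite !qqpochS !(qpochS _ m.+1) !(qpochS z) !(qpochS c).
  rewrite QE !exprS; set y := q ^+ (M - m.+1); set x := q ^+ m.
  have cm := cN0 m; have cx := cq m; rewrite /c -/x in cm cx *.
  have qx := q_nroot m; have qy := q_nroot (M - m.+1).
  rewrite exprS -/x in qx; rewrite exprS -/y in qy.
  by field; rewrite cx cm qx qy !qqpoch_neq0.
(* The recurrence stops at i = M. The sum for M + 1 has one more term, and [F M M.+1] would be
   spurious since M - i is truncated. *)
have last_term : (1 - q * Q) * (1 - c * Q) * F M.+1 M.+1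
    = qpoch A q M.+1 * qpoch B q M.+1 * z ^+ M.+1 / (qq M * qpoch c q M).
  rewrite /F subnn qpoch0 qqpoch0 qqpochS (qpochS c) (exprS q) -/Q; field.
  by rewrite qqpoch_neq0 cN0 cq -exprS q_nroot.
have qQ : 1 - q * Q != 0 by rewrite -exprS.
have := telescope M (leqnn M); rewrite subnn expr0 mulN1r qpoch0 qqpoch0.
rewrite (IH : \sum_(i < M.+1) F M i = _) => /eqP.
rewrite subr_eq => /eqP E; apply: (mulfI (mulf_neq0 qQ (cq M))).
rewrite -/Q (big_ord_recr M.+1) /= mulrDr -/(F _ _) last_term {}E.
rewrite qqpochS !(qpochS _ M) (exprS q) -/Q; field.
by rewrite qqpoch_neq0 cN0 cq qQ.
Qed.

Lemma tri_psumS n : psum n.+1 = psum n + q ^- tri n.+1.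
Proof. by rewrite /tri_psum big_nat_recr. Qed.

(** As k(k+1) is twice a triangular number, everything becomes rational in q, T, x and [psum k], the
    form that [field] can treat. *)
Lemma bailey_alphaE k (T := q ^+ tri k) (x := q ^+ k) :
  alpha k.+1 = (-1) ^+ k.+1 * (1 + q * x) * T ^+ 2
    * ((T * (q * x))^-1 - (1 - q * x) * (psum k + (T * (q * x))^-1)).
Proof.
rewrite /bailey_alpha (_ : k.+1 * k = tri k * 2)%N; last first.
  by rewrite /tri divnK 1?mulnC // dvdn2 oddM /=; case: odd.
by rewrite exprM tri_psumS triS exprD (exprS q) -/T -/x.
Qed.

(** * Telescoping proof of the Bailey pair *)

Local Notation w n r := (qq (n - r) * qq (n + r))^-1.

Lemma bailey_weightS n r : (r < n)%N ->
  w n r.+1 = w n r * (1 - q ^+ (n - r)) / (1 - q ^+ (n + r).+1).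
Proof.
move=> lt_rn; rewrite addnS qqpochS -(subnSK lt_rn) qqpochS; field.
by rewrite !q_nroot !qqpoch_neq0.
Qed.

(* Gosper summation: the summand is the difference of two consecutive values of
   the right-hand side, which vanishes at [m = n]. *)
Lemma bailey_telescope n m (N := q ^+ n) (x := q ^+ m) (T := q ^+ tri m) :
    (0 < n)%N -> (m <= n)%N ->
  \sum_(r < m.+1) alpha r * w n r
     * (q ^- r + q ^+ r - N - N / q)
  = (-1) ^+ m * (1 - N / x) * w n m * (T / (q * x))
    * ((1 - N + (q - N) * x) / (1 - N) - T * (1 - q * x ^+ 2) * psum m).
Proof.
move=> n_gt0; have N1 : 1 - N != 0 by rewrite /N -(prednK n_gt0) q_nroot.
rewrite {}/x {}/T; elim: m => [_|m IH lt_mn].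
  rewrite big_ord_recl big_ord0 /= /tri_psum big_nat1 /tri mul0n div0n !expr0; field.
  by rewrite N1 q_neq0 !qqpoch_neq0.
rewrite big_ord_recr /= -/(alpha m.+1) IH ?(ltnW lt_mn) // bailey_weightS //.
rewrite bailey_alphaE tri_psumS triS exprD !exprS.
have xn : q ^+ (n - m) = N / q ^+ m.
  apply: (canRL (mulfK (expf_neq0 m q_neq0))).
  by rewrite -exprD subnK // ltnW.
have Nxq := q_nroot (n + m)%N; rewrite exprS exprD -/N in Nxq.
rewrite exprD -/N xn.
have T0 : q ^+ tri m != 0 by rewrite expf_neq0.
have x0 : q ^+ m != 0 by rewrite expf_neq0.
move: T0 x0 Nxq; move: (q ^+ tri m) (q ^+ m) => T x T0 x0 Nxq.
field.
by rewrite N1 q_neq0 T0 x0 Nxq !qqpoch_neq0.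
Qed.

Lemma bailey_pair n :
  \sum_(r < n.+1) alpha r / (qq (n - r) * qq (n + r))
  = (\prod_(k < n) (1 - q ^+ (k.*2).+1))^-1.
Proof.
elim: n => [|n IH].
  by rewrite big_ord_recr !big_ord0 /= subnn addn0 qqpoch0 mulr1 add0r divr1 invr1.
rewrite [in RHS]big_ord_recr /= invfM -{}IH.
apply: (canRL (mulfK (q_nroot _))).
rewrite mulr_suml.
(* Both sums receive the weights of n + 1; the added term r = n + 1 vanishes through its factor 1 -
   q^0. *)
have -> : \sum_(r < n.+1) alpha r / (qq (n - r) * qq (n + r))
  = \sum_(r < n.+2) alpha r * w n.+1 r
      * (1 - q ^+ (n.+1 - r)) * (1 - q ^+ (n.+1 + r)).
  rewrite [RHS]big_ord_recr /= subnn expr0 subrr mulr0 mul0r addr0.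
  apply: eq_bigr => -[r /= lt_rn] _; rewrite subSn // addSn !qqpochS; field.
  by rewrite !q_nroot !qqpoch_neq0.
apply/eqP; rewrite -subr_eq0 -sumrB; apply/eqP.
(* With N = q^(n+1), (1 - N^2/q) - (1 - N/q^r)(1 - N q^r) = N (q^-r + q^r - N - N/q), so the
   difference is N times a sum that telescopes to a multiple of 1 - N/N = 0. *)
have := bailey_telescope (ltn0Sn n) (leqnn n.+1).
rewrite divff ?expf_neq0 // subrr mulr0 !mul0r => E.
rewrite -[RHS](mulr0 (q ^+ n.+1)) -[in RHS]E mulr_sumr.
apply: eq_bigr => -[r /= le_rn] _.
have -> : q ^+ (n.+1 - r) = q ^+ n.+1 / q ^+ r.
  apply: (canRL (mulfK (expf_neq0 r q_neq0))).
  by rewrite -exprD subnK.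
rewrite exprD (_ : (n.*2).+1 = n + n.+1)%N; last by lia.
rewrite exprD exprS; field.
by rewrite q_neq0 expf_neq0 // !qqpoch_neq0.
Qed.

(** This is [q_saalschutz] at A q^r, B q^r and N - r. Since ABz = q, its c is q^(2r+1), which
    matches (q; q)_(2r+i) = (q; q)_(2r) (q^(2r+1); q)_i. *)
Lemma bailey_lemma_coef A B z N r (a := B * z) (b := A * z) :
    A * B * z = q -> (r <= N)%N ->
    (forall k, 1 - a * q ^+ k != 0) -> (forall k, 1 - b * q ^+ k != 0) ->
  \sum_(i < (N - r).+1)
     qpoch A q (i + r) * qpoch B q (i + r) * z ^+ (i + r) * qpoch z q (N - (i + r))
     / qq (N - (i + r)) / (qq (i + r - r) * qq (i + r + r))
  = qpoch a q N * qpoch b q N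
    * (qpoch A q r * qpoch B q r * z ^+ r / (qpoch a q r * qpoch b q r))
    / (qq (N - r) * qq (N + r)).
Proof.
move=> ABz le_rN aq bq.
have cE : A * q ^+ r * (B * q ^+ r) * z = q ^+ (r + r).+1.
  by rewrite exprS exprD -ABz; ring.
have qqD m n : qq (m + n) = qq m * qpoch (q ^+ m.+1) q n.
  by rewrite /qqpoch qpochD exprS.
have cq k : 1 - A * q ^+ r * (B * q ^+ r) * z * q ^+ k != 0.
  by rewrite cE -exprD addSn q_nroot.
transitivity (qpoch A q r * qpoch B q r * z ^+ r / qq (r + r)
  * \sum_(i < (N - r).+1) qpoch (A * q ^+ r) q i * qpoch (B * q ^+ r) q i
      * qpoch z q (N - r - i) * z ^+ i
      / (qq i * qq (N - r - i) * qpoch (q ^+ (r + r).+1) q i)).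
  rewrite mulr_sumr; apply: eq_bigr => -[i /= _] _.
  rewrite (addnC i r) subnDA addKn -addnA (addnC i r) addnA.
  rewrite (qqD (r + r)%N) !qpochD exprD.
  by field; rewrite !qqpoch_neq0 qpochq_neq0.
rewrite -cE q_saalschutz // cE.
have -> : (N + r = r + r + (N - r))%N by lia.
have qN x : qpoch x q N = qpoch x q r * qpoch (x * q ^+ r) q (N - r).
  by rewrite -qpochD subnKC.
rewrite (qqD (r + r)%N) (qN a) (qN b) /a /b ![_ * q ^+ r * z]mulrAC; field.
by rewrite !qqpoch_neq0 qpochq_neq0 !qpoch_neq0.
Qed.

(** Each summand is a part independent of N times a factor that converges as N grows, the shape that
    [tannery] takes. *)
Lemma bailey_lemma (u v : nat -> C) A B z N (a := B * z) (b := A * z) :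
    A * B * z = q ->
    (forall k, 1 - a * q ^+ k != 0) -> (forall k, 1 - b * q ^+ k != 0) ->
    (forall n, \sum_(r < n.+1) u r / (qq (n - r) * qq (n + r)) = v n) ->
  \sum_(j < N.+1) qpoch A q j * qpoch B q j * z ^+ j * v j
     * (qpoch z q (N - j) / qq (N - j))
  = qpoch a q N * qpoch b q N * \sum_(r < N.+1)
     qpoch A q r * qpoch B q r * z ^+ r / (qpoch a q r * qpoch b q r) * u r
     / (qq (N - r) * qq (N + r)).
Proof.
move=> ABz aq bq vE.
pose F j r := qpoch A q j * qpoch B q j * z ^+ j * qpoch z q (N - j)
     / qq (N - j) / (qq (j - r) * qq (j + r)) * u r.
transitivity (\sum_(j < N.+1) \sum_(r < N.+1 | (r < j.+1)%N) F j r).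
  apply: eq_bigr => -[j /= lt_jN] _; rewrite -vE.
  rewrite -(big_ord_widen _ (F j)) // mulr_sumr mulr_suml.
  apply: eq_bigr => -[r /= _] _.
  by rewrite /F; field; rewrite !qqpoch_neq0.
rewrite (exchange_big_dep xpredT) //= mulr_sumr.
apply: eq_bigr => -[r /= lt_rN] _.
rewrite -(big_geq_mkord r _ xpredT (F^~ r)) /=.
rewrite (big_addn 0%N N.+1 r xpredT (F^~ r)) big_mkord subSn //.
by rewrite -mulr_suml bailey_lemma_coef //; field; rewrite !qqpoch_neq0 !qpoch_neq0.
Qed.

End FiniteIdentities.

(** * Geometric domination over the complex numbers *)

Section GeometricMajorants.
Variable R : realType.
Local Notation C := (Cplx R).
Implicit Types (K M l s x z : C) (u h : nat -> C).

(** The complex order compares only numbers with equal imaginary parts, so nonnegative bounds are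
    real and can be moved to R. *)
Lemma ReC_ge0 x : 0 <= x -> x = (complex.Re x)%:C%C.
Proof. by move=> x0; rewrite RRe_real // ger0_real. Qed.

Lemma cvg_real_complex (f : nat -> R) (l : R) :
  f @ \oo --> l -> (fun n => (f n)%:C%C : C) @ \oo --> (l%:C%C : C).
Proof.
move=> /cvgrPdist_lt fl; apply/cvgrPdist_lt => e e0.
have eE := ReC_ge0 (ltW e0); have re0 : 0 < complex.Re e by rewrite eE ltcR in e0.
near=> n; rewrite -rmorphB eE normc_def /= expr0n addr0 sqrtr_sqr ltcR.
by near: n; apply: fl.
Unshelve. all: by end_near. Qed.

(** Real and imaginary parts are dominated by a real geometric series, so each converges
    absolutely. *)
Lemma cvg_geometric_dominated u K z : `|z| < 1 ->
  (forall n, `|u n| <= K * `|z| ^+ n) -> cvgn (series u).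
Proof.
move=> z1 uK.
have zE := ReC_ge0 (normr_ge0 z); set r := complex.Re `|z| in zE.
have K0 : 0 <= K by have := uK 0%N; rewrite expr0 mulr1; apply: le_trans.
have KE := ReC_ge0 K0; set k := complex.Re K in KE.
have r0 : 0 <= r by rewrite -lecR -zE; apply: normr_ge0.
have r1 : `|r| < 1 by rewrite ger0_norm // -ltcR -zE.
have uk n : complex.Re `|u n| <= geometric k r n.
  by rewrite -lecR -(ReC_ge0 (normr_ge0 _)) (le_trans (uK n)) // {1}KE zE
     -rmorphXn -rmorphM.
have part (p : C -> R) : (forall x, `|p x| <= complex.Re `|x|) ->
    cvgn (series (p \o u)).
  move=> ple; apply: normed_cvg; apply: series_le_cvg.
  - by move=> n; apply: normr_ge0.
  - by move=> n; apply: le_trans (uk n); apply: le_trans (ple _).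
  - by move=> n; apply: le_trans (uk n); apply: ple.
  - exact: is_cvg_geometric_series.
have [/part/cvg_ex[l1 cl1] /part/cvg_ex[l2 cl2]] :
    (forall x, `|complex.Re x| <= complex.Re `|x|)
    /\ (forall x, `|complex.Im x| <= complex.Re `|x|).
  by split=> -[x y];
    rewrite normc_def /= -sqrtr_sqr ler_wsqrtr // ?lerDl ?lerDr sqr_ge0.
apply/cvg_ex; exists ((l1%:C + 'i * l2%:C)%C : C).
rewrite (_ : series u = (fun n => (series (@complex.Re R \o u) n)%:C%C
   + 'i%C * (series (@complex.Im R \o u) n)%:C%C)); last first.
  apply/funext => n; rewrite /series /= !rmorph_sum mulr_sumr -big_split /=.
  by apply: eq_bigr => i _; rewrite -complexE.
exact: cvgD (cvg_real_complex cl1)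
  (cvgMl_tmp (a := 'i%C : C) (cvg_real_complex cl2)).
Qed.

Lemma cvg_norm_expr z : `|z| < 1 -> (fun n => `|z| ^+ n) @ \oo --> (0 : C).
Proof.
move=> z1; apply: cvg_series_cvg_0.
by apply: (@cvg_geometric_dominated _ 1 z) => // n; rewrite normrX normr_id mul1r.
Qed.

Lemma geometric_tail_le z m n : `|z| < 1 ->
  \sum_(m <= i < n) `|z| ^+ i <= `|z| ^+ m / (1 - `|z|).
Proof.
move=> z1; have z1' : 0 < 1 - `|z| by rewrite subr_gt0.
rewrite ler_pdivlMr //; have [le_mn|lt_nm] := leqP m n; last first.
  by rewrite big_geq ?mul0r ?exprn_ge0 // ltnW.
have -> : (\sum_(m <= i < n) `|z| ^+ i) * (1 - `|z|) = `|z| ^+ m - `|z| ^+ n.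
  rewrite mulr_suml -[RHS]opprB -(telescope_sumr _ le_mn) -sumrN.
  by apply: eq_bigr => i _; rewrite exprS; ring.
by rewrite lerBlDr lerDl exprn_ge0.
Qed.

(** Cut at J: the tail is at most K M |z|^J / (1 - |z|) < eps/2 uniformly in N, and the first J
    terms form a finite sum of null sequences. *)
Lemma tannery0 h (e : nat -> nat -> C) K M z : `|z| < 1 ->
    (forall n, `|h n| <= K * `|z| ^+ n) ->
    (forall N n, (n <= N)%N -> `|e N n| <= M) ->
    (forall n, (e ^~ n) @ \oo --> (0 : C)) ->
  (fun N => \sum_(n < N.+1) h n * e N n) @ \oo --> (0 : C).
Proof.
move=> z1 hK eM e0.
have z1' : 0 < 1 - `|z| by rewrite subr_gt0.
have K0 : 0 <= K by have := hK 0%N; rewrite expr0 mulr1; apply: le_trans.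
have M0 : 0 <= M by apply: le_trans (eM 0%N 0%N _).
pose L := K * M / (1 - `|z|).
have L0 : 0 <= L by rewrite divr_ge0 ?mulr_ge0 // ltW.
apply/cvgrPdist_lt => eps eps0.
have eps2 : 0 < eps / 2 by rewrite divr_gt0.
have [J _ HJ] : \forall J \near \oo, L * `|z| ^+ J < eps / 2.
  have /cvgrPdist_lt/(_ _ eps2) : (fun n => L * `|z| ^+ n) @ \oo --> (0 : C).
    by rewrite -(mulr0 L); apply: cvgMl_tmp; apply: cvg_norm_expr.
  apply: filterS => n; rewrite sub0r normrN ger0_norm //.
  by rewrite mulr_ge0 ?exprn_ge0.
have {}HJ := HJ J (leqnn J).
have head : (fun N => \sum_(n < J) h n * e N n) @ \oo --> (0 : C).
  suff : (fun N => \sum_(n < J) h n * e N n) @ \oo --> (\sum_(n < J) 0 : C).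
    by rewrite big1.
  apply: cvg_big => [|i _]; first exact: add_continuous.
  by rewrite -(mulr0 (h i)); apply: cvgMl_tmp; apply: e0.
move/cvgrPdist_lt/(_ _ eps2): head => head.
near=> N; rewrite sub0r normrN.
have le_JN : (J <= N.+1)%N by apply: leqW; near: N; apply: nbhs_infty_ge.
rewrite -(big_mkord xpredT (fun n => h n * e N n)) (big_cat_nat (leq0n J) le_JN) //=.
rewrite big_mkord (le_lt_trans (ler_normD _ _)) // [eps]splitr ltr_leD //.
  by rewrite -normrN -sub0r; near: N.
apply: le_trans (ltW HJ); rewrite (le_trans (ler_norm_sum _ _ _)) //.
apply: (@le_trans _ _ (\sum_(J <= i < N.+1) K * M * `|z| ^+ i)).
  rewrite !big_nat ler_sum // => i /andP[_ lt_iN]; rewrite normrM mulrAC.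
  by rewrite ler_pM // eM.
rewrite -mulr_sumr /L -[leRHS]mulrA [_^-1 * _]mulrC.
by rewrite ler_wpM2l ?mulr_ge0 // geometric_tail_le.
Unshelve. all: by end_near. Qed.

Lemma cvg_reindex u (phi : nat -> nat) (l : C) :
    (forall m, exists N, forall n, (N <= n -> m <= phi n)%N) ->
  u @ \oo --> l -> (fun n => u (phi n)) @ \oo --> l.
Proof.
move=> phi_oo /cvgrPdist_lt ul; apply/cvgrPdist_lt => e e0.
have [m _ um] := ul e e0; have [N mphi] := phi_oo m.
by exists N => // n /= le_Nn; apply: um => /=; apply: mphi.
Qed.

(** All columns of c share the limit l, so subtracting l reduces to [tannery0]. *)
Lemma tannery h (c : nat -> nat -> C) K M z s l : `|z| < 1 ->
    (forall n, `|h n| <= K * `|z| ^+ n) ->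
    (forall N n, (n <= N)%N -> `|c N n| <= M) ->
    (forall n, (c ^~ n) @ \oo --> l) -> series h @ \oo --> s ->
  (fun N => \sum_(n < N.+1) h n * c N n) @ \oo --> s * l.
Proof.
move=> z1 hK cM cl hs.
rewrite (_ : (fun N => _) = (fun N => series h N.+1 * l
    + \sum_(n < N.+1) h n * (c N n - l))); last first.
  apply/funext => N; rewrite /series /= big_mkord mulr_suml -big_split /=.
  by apply: eq_bigr => i _; rewrite -mulrDr addrC subrK.
have err : (fun N => \sum_(n < N.+1) h n * (c N n - l)) @ \oo --> (0 : C).
  apply: (@tannery0 h (fun N n => c N n - l) K (M + `|l|) z z1 hK) => [N n le_nN|n].
    by rewrite (le_trans (ler_normB _ _)) // lerD2r cM.
  apply/cvgrPdist_lt => eps eps0; move/cvgrPdist_lt: (cl n) => /(_ _ eps0).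
  by apply: filterS => N; rewrite sub0r opprB.
have sl : (fun N => series h N.+1 * l) @ \oo --> s * l.
  have hs1 : (fun N => series h N.+1) @ \oo --> s.
    by apply: (cvg_reindex (phi := succn)) hs => m; exists m => n /leqW.
  exact: cvgMr_tmp hs1.
by have H := cvgD sl err; rewrite addr0 in H; exact: H.
Qed.

(** By 1 + t <= exp t, the products stay below exp(K / (1 - |z|)). *)
Lemma prod_bounded (d : nat -> C) K z : 0 <= K -> `|z| < 1 ->
    (forall k, `|d k| <= 1 + K * `|z| ^+ k) ->
  exists2 M, 0 < M & forall n, `|\prod_(k < n) d k| <= M.
Proof.
move=> K0 z1 dK; have z1' : 0 < 1 - `|z| by rewrite subr_gt0.
pose L := K / (1 - `|z|).
have LE := ReC_ge0 (divr_ge0 K0 (ltW z1') : 0 <= L).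
exists (expR (complex.Re L))%:C%C; first by rewrite ltcR expR_gt0.
move=> n; rewrite normr_prod.
have /le_trans : \prod_(k < n) `|d k| <= \prod_(k < n) (1 + K * `|z| ^+ k).
  by apply: ler_prod => k _; rewrite normr_ge0 dK.
apply.
have Kz k : 0 <= K * `|z| ^+ k by rewrite mulr_ge0 ?exprn_ge0.
apply: (@le_trans _ _ (expR (\sum_(k < n) complex.Re (K * `|z| ^+ k)))%:C%C).
  rewrite expR_sum rmorph_prod; apply: ler_prod => k _.
  rewrite addr_ge0 //= {1}(ReC_ge0 (Kz k)) -(rmorph1 (real_complex R)) -rmorphD.
  by rewrite lecR expR_ge1Dx.
rewrite lecR ler_expR -lecR -LE rmorph_sum /=.
under eq_bigr do rewrite -ReC_ge0 //.
by rewrite -mulr_sumr ler_wpM2l // -(big_mkord xpredT (fun k => `|z| ^+ k))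
  (le_trans (geometric_tail_le _ _ z1)) // expr0 mul1r.
Qed.

End GeometricMajorants.

Lemma limn_eq (K : numFieldType) (u : nat -> K) (l : K) :
  u @ \oo --> l -> limn u = l.
Proof. exact: (cvg_lim (@norm_hausdorff K K)). Qed.

(** Here w, x, y1, y2 stand for the infinite products of q, z, a, b, and p, s for the two series;
    the last hypothesis equates the limits of both sides of [bailey_lemma]. *)
Lemma bailey_limit_solve (F : fieldType) (w x y1 y2 p s : F) :
    w != 0 -> y1 != 0 -> y2 != 0 ->
  y1 * y2 * (s * (w^-1 * w^-1)) = p * (x * w^-1) -> w * x / (y1 * y2) * p = s.
Proof.
move=> w0 y10 y20 E.
have -> : w * x / (y1 * y2) * p = w * w / (y1 * y2) * (p * (x * w^-1)).
  by field; rewrite w0 y10 y20.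
by rewrite -E; field; rewrite w0 y10 y20.
Qed.

(** * Limits of q-Pochhammer symbols and of Bailey's lemma *)

Section QPochhammerLimits.
Variables (R : realType) (q : Cplx R).
Hypotheses (q_neq0 : q != 0) (q_lt1 : `|q| < 1).
Local Notation C := (Cplx R).
Local Notation qq := (qqpoch q).
Implicit Types (x : C) (u : nat -> C).

Lemma norm_expr_le1 n : `|q ^+ n| <= 1.
Proof. by rewrite normrX exprn_ile1 // ltW. Qed.

Lemma sub_neq0_lt1 x : `|x| < 1 -> 1 - x != 0.
Proof.
by move=> x1; rewrite subr_eq0; apply: contraTneq x1 => <-; rewrite normr1 ltxx.
Qed.

Lemma qfactor_neq0 x k : `|x| < 1 -> 1 - x * q ^+ k != 0.
Proof.
move=> x1; apply: sub_neq0_lt1; rewrite normrM; apply: le_lt_trans x1.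
by rewrite ler_piMr ?norm_expr_le1.
Qed.

Lemma q_nroot_lt1 k : 1 - q ^+ k.+1 != 0.
Proof. by rewrite exprS qfactor_neq0. Qed.

Lemma qpoch_bounded x : exists2 M, 0 < M & forall n, `|qpoch x q n| <= M.
Proof.
apply: (@prod_bounded _ (fun k => 1 - x * q ^+ k) `|x| q) => // k.
by rewrite (le_trans (ler_normB _ _)) // normr1 normrM normrX.
Qed.

(** Put w = |q|^k / (1 - |x|) and y = |x| |q|^k. As y is at most |x| and |q|^k, w (1 - y) >= |q|^k
    >= y, so (1 + w)(1 - y) >= 1 and [prod_bounded] applies to the inverse factors. *)
Lemma qpochV_bounded x : `|x| < 1 ->
  exists2 M, 0 < M & forall n, `|(qpoch x q n)^-1| <= M.
Proof.
move=> x1; have x1' : 0 < 1 - `|x| by rewrite subr_gt0.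
have [|k|M M0 dM] := @prod_bounded _ (fun k => (1 - x * q ^+ k)^-1)
  (1 - `|x|)^-1 q _ q_lt1; first by rewrite invr_ge0 ltW.
- set w := _ * `|q| ^+ k; have w0 : 0 <= w.
    by rewrite mulr_ge0 ?exprn_ge0 // invr_ge0 ltW.
  have wE : w * (1 - `|x|) = `|q| ^+ k by rewrite mulrAC mulVf ?mul1r ?gt_eqF.
  have n0 : 0 < `|1 - x * q ^+ k| by rewrite normr_gt0 qfactor_neq0.
  have yx : `|x| * `|q| ^+ k <= `|x| by rewrite ler_piMr // -normrX norm_expr_le1.
  have yq : `|x| * `|q| ^+ k <= `|q| ^+ k by rewrite ler_piMl ?exprn_ge0 // ltW.
  have ny : 1 - `|x| * `|q| ^+ k <= `|1 - x * q ^+ k|.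
    by rewrite -normrX -normrM -{1}(normr1 C) lerB_dist.
  rewrite normfV -[X in X <= _]mul1r ler_pdivrMr //.
  apply: le_trans (ler_wpM2l _ ny); last by rewrite addr_ge0.
  rewrite mulrDl mul1r -lerBlDl opprB addrCA subrr addr0.
  apply: (le_trans yq); rewrite -[leLHS]wE ler_wpM2l //.
  by rewrite lerD2l lerN2.
- by exists M => // n; rewrite /qpoch -prodfV; apply: dM.
Qed.

(** The increments -x q^k (x; q)_k are geometrically dominated because (x; q)_k is bounded. *)
Lemma qpoch_cvg x : qpoch x q @ \oo --> qpoch_oo x q.
Proof.
have [M M0 xM] := qpoch_bounded x.
have /cvg_ex[/= l sl] : cvgn (series (fun k => - (x * q ^+ k) * qpoch x q k)).
  apply: (@cvg_geometric_dominated _ _ (`|x| * M) q) => // k.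
  rewrite normrM normrN normrM normrX mulrAC ler_wpM2r ?exprn_ge0 //.
  by rewrite ler_wpM2l.
suff cx : qpoch x q @ \oo --> (1 + l : C).
  by rewrite (_ : qpoch_oo x q = 1 + l) //; apply: limn_eq.
have -> : qpoch x q = fun n => 1 + series (fun k => - (x * q ^+ k) * qpoch x q k) n.
  apply/funext => n; elim: n => [|n IH].
    by rewrite qpoch0 /series /= big_geq // addr0.
  by rewrite qpochS seriesSr addrA -IH; ring.
by have H := cvgD (cvg_cst (1 : C)) sl; exact: H.
Qed.

(** Bounded inverses keep the partial products away from 0. *)
Lemma qpoch_oo_neq0 x : `|x| < 1 -> qpoch_oo x q != 0.
Proof.
move=> x1; have [M M0 xM] := qpochV_bounded x1.
apply/eqP => x0; have := qpoch_cvg (x := x); rewrite x0.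
have M1 : 0 < M^-1 by rewrite invr_gt0.
move=> /cvgrPdist_lt/(_ _ M1)[N _ /(_ N (leqnn N))] /=.
rewrite sub0r normrN -[M^-1]mul1r ltr_pdivlMr // => small.
have u0 : 0 < `|qpoch x q N|.
  by rewrite normr_gt0 qpoch_neq0 // => k; apply: qfactor_neq0.
have := xM N; rewrite normfV -[_^-1]mulr1 ler_pdivrMl // => /le_lt_trans/(_ small).
by rewrite ltxx.
Qed.

(** The bound D is the fixed point of D = |q| D + 1, and one step multiplies by q^(2(k+1)) and adds
    a power of q. *)
Lemma tri_psum_bounded k :
  `|q ^+ tri k ^+ 2 * tri_psum q k| <= (1 - `|q|)^-1.
Proof.
have q1 : 0 < 1 - `|q| by rewrite subr_gt0.
have D1 : `|q| * (1 - `|q|)^-1 + 1 = (1 - `|q|)^-1.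
  by field; rewrite gt_eqF.
elim: k => [|k IH].
  rewrite /tri_psum big_nat1 /tri !expr0 expr1n invr1 mulr1 normr1 -D1.
  by rewrite lerDr mulr_ge0 // invr_ge0 ltW.
have -> : q ^+ tri k.+1 ^+ 2 * tri_psum q k.+1
    = q ^+ k.+1 ^+ 2 * (q ^+ tri k ^+ 2 * tri_psum q k) + q ^+ tri k.+1.
  by rewrite tri_psumS triS exprD; field; rewrite !expf_neq0.
rewrite (le_trans (ler_normD _ _)) // -D1 lerD ?norm_expr_le1 //.
rewrite normrM ler_pM // -exprM mulnC mul2n -addnn addSn exprS normrM.
by rewrite ler_piMr ?norm_expr_le1.
Qed.

Lemma bailey_alpha_bounded n :
  `|bailey_alpha q n| <= 2 * (1 + 2 * (1 - `|q|)^-1).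
Proof.
have q1 : 0 < 1 - `|q| by rewrite subr_gt0.
have D0 : 0 <= 2 * (1 - `|q|)^-1 by rewrite mulr_ge0 // invr_ge0 ltW.
have le2 : `|1 : C| + 1 <= 2 by rewrite normr1.
case: n => [|k].
  rewrite normr1 mulrDr mulr1 -[X in X <= _]addr0 lerD ?ler1n //.
  by rewrite mulr_ge0.
(* The two terms in q^(-tri (k+1)) combine and lose a factor q^(-(k+1)); T^2 absorbs the remaining
   negative power. *)
have -> : bailey_alpha q k.+1 = (-1) ^+ k.+1 * ((1 + q ^+ k.+1)
    * (q ^+ tri k - (1 - q ^+ k.+1) * (q ^+ tri k ^+ 2 * tri_psum q k))).
  by rewrite bailey_alphaE // (exprS q); field; rewrite q_neq0 !expf_neq0.
rewrite normrM normrX normrN1 expr1n mul1r normrM.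
rewrite ler_pM // (le_trans (ler_normD _ _)) ?(le_trans _ le2) //.
  by rewrite lerD2l norm_expr_le1.
rewrite normrN lerD ?norm_expr_le1 // normrM ler_pM ?tri_psum_bounded //.
by rewrite (le_trans (ler_normB _ _)) // (le_trans _ le2) // lerD2l norm_expr_le1.
Qed.

Lemma cvg_subn u j (l : C) : u @ \oo --> l -> (fun n => u (n - j)%N) @ \oo --> l.
Proof. by apply: cvg_reindex => m; exists (m + j)%N => n; lia. Qed.

Lemma cvg_addn u j (l : C) : u @ \oo --> l -> (fun n => u (n + j)%N) @ \oo --> l.
Proof. by apply: cvg_reindex => m; exists m => n; lia. Qed.

Lemma qqpochV_cvg : (fun n => (qq n)^-1) @ \oo --> ((qpoch_oo q q)^-1 : C).
Proof. by apply: cvgV; [apply: qpoch_oo_neq0 | apply: qpoch_cvg]. Qed.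

Lemma qpoch_quotient_cvg z j :
  (fun n => qpoch z q (n - j) / qq (n - j)) @ \oo
    --> (qpoch_oo z q * (qpoch_oo q q)^-1 : C).
Proof.
have cz : (fun n => qpoch z q (n - j)) @ \oo --> (qpoch_oo z q : C).
  by apply: cvg_subn; apply: qpoch_cvg.
by have H := cvgM cz (cvg_subn j qqpochV_cvg); exact: H.
Qed.

Lemma qqpoch_pair_cvg j :
  (fun n => (qq (n - j) * qq (n + j))^-1) @ \oo
    --> ((qpoch_oo q q)^-1 * (qpoch_oo q q)^-1 : C).
Proof.
have -> : (fun n => (qq (n - j) * qq (n + j))^-1)
    = (fun n => (qq (n - j))^-1 * (qq (n + j))^-1).
  by apply/funext => n; rewrite invfM.
by have H := cvgM (cvg_subn j qqpochV_cvg) (cvg_addn j qqpochV_cvg); exact: H.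
Qed.

(** Boundedness of u and v suffices because z^n supplies the geometric decay; the N-dependent
    factors tend to (z; q)_oo / (q; q)_oo and 1 / (q; q)_oo^2. *)
Lemma bailey_limit (u v : nat -> C) Ku Kv A B z (a := B * z) (b := A * z) :
    A * B * z = q -> `|z| < 1 -> `|a| < 1 -> `|b| < 1 ->
    (forall n, `|u n| <= Ku) -> (forall n, `|v n| <= Kv) ->
    (forall n, \sum_(r < n.+1) u r / (qq (n - r) * qq (n + r)) = v n) ->
  exists phi S : C,
  [/\ series (fun n => qpoch A q n * qpoch B q n * z ^+ n * v n) @ \oo --> phi,
      series (fun n => qpoch A q n * qpoch B q n * z ^+ n
        / (qpoch a q n * qpoch b q n) * u n) @ \oo --> S &
      qpoch_oo q q * qpoch_oo z q / (qpoch_oo a q * qpoch_oo b q) * phi = S].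
Proof.
move=> ABz z1 a1 b1 uK vK uv.
have [MA MA0 bA] := qpoch_bounded A.
have [MB MB0 bB] := qpoch_bounded B.
have [Mz Mz0 bz] := qpoch_bounded z.
have [Ma Ma0 ba] := qpochV_bounded a1.
have [Mb Mb0 bb] := qpochV_bounded b1.
have [Mq Mq0 bq] := qpochV_bounded q_lt1.
set hv := fun n => qpoch A q n * qpoch B q n * z ^+ n * v n.
set hu := fun n => _ / (_ * _) * u n.
have hv_le n : `|hv n| <= MA * MB * Kv * `|z| ^+ n.
  rewrite /hv mulrAC normrM [`|z ^+ n|]normrX ler_wpM2r ?exprn_ge0 //.
  by rewrite !normrM !ler_pM ?mulr_ge0.
have hu_le n : `|hu n| <= MA * MB * (Ma * Mb) * Ku * `|z| ^+ n.
  have -> : hu n = qpoch A q n * qpoch B q n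
      * ((qpoch a q n)^-1 * (qpoch b q n)^-1) * u n * z ^+ n.
    by rewrite /hu invfM; ring.
  rewrite normrM [`|z ^+ n|]normrX ler_wpM2r ?exprn_ge0 //.
  by rewrite 4!normrM !ler_pM ?mulr_ge0.
have [phi lv] : exists l : C, series hv @ \oo --> l.
  by apply/cvg_ex; apply: cvg_geometric_dominated z1 hv_le.
have [S lu] : exists l : C, series hu @ \oo --> l.
  by apply/cvg_ex; apply: cvg_geometric_dominated z1 hu_le.
exists phi, S; split; [exact: lv | exact: lu |].
have limL : (fun N => \sum_(n < N.+1) hv n
      * (qpoch z q (N - n) / qq (N - n))) @ \oo
    --> (phi * (qpoch_oo z q * (qpoch_oo q q)^-1) : C).
  apply: (@tannery _ hv (fun N n => qpoch z q (N - n) / qq (N - n))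
    _ (Mz * Mq) z _ _ z1 hv_le _ _ lv) => [N n _|n].
    by rewrite normrM ler_pM //; apply: bq.
  exact: qpoch_quotient_cvg.
have limR : (fun N => \sum_(n < N.+1) hu n
      * (qq (N - n) * qq (N + n))^-1) @ \oo
    --> (S * ((qpoch_oo q q)^-1 * (qpoch_oo q q)^-1) : C).
  apply: (@tannery _ hu (fun N n => (qq (N - n) * qq (N + n))^-1)
    _ (Mq * Mq) z _ _ z1 hu_le _ _ lu) => [N n _|n].
    by rewrite invfM normrM ler_pM //; apply: bq.
  exact: qqpoch_pair_cvg.
have limR' : (fun N => qpoch a q N * qpoch b q N
      * \sum_(n < N.+1) hu n * (qq (N - n) * qq (N + n))^-1) @ \oo
    --> (qpoch_oo a q * qpoch_oo b q
      * (S * ((qpoch_oo q q)^-1 * (qpoch_oo q q)^-1)) : C).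
  exact: cvgM (cvgM (qpoch_cvg (x := a)) (qpoch_cvg (x := b))) limR.
have key := bailey_lemma q_neq0 q_nroot_lt1 _ ABz
  (fun k => qfactor_neq0 k a1) (fun k => qfactor_neq0 k b1) uv.
have E := limn_eq limL; rewrite (funext key) (limn_eq limR') in E.
exact: bailey_limit_solve (qpoch_oo_neq0 q_lt1) (qpoch_oo_neq0 a1)
  (qpoch_oo_neq0 b1) E.
Qed.

End QPochhammerLimits.

(** * Specialization to A = q/a, B = q/b and z = ab/q *)

Theorem theorem5p6 (R : realType) (q a b sq : Cplx R)
    (q_neq0 : q != 0) (a_neq0 : a != 0) (b_neq0 : b != 0)
    (q_lt1 : `|q| < 1)
    (ab_lt1 : Num.max `|a * b / q| (Num.max `|a| `|b|) < 1)
    (sq2 : sq ^+ 2 = q) :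
  let t (n : nat) : Cplx R :=
    (1 + q ^+ n) * q ^ (n%:Z ^+ 2 - 2 * n%:Z)
    * (qpochs [:: q / a; q / b] q n / qpochs [:: a; b] q n)
    * (- (a * b)) ^+ n
    * (q ^- ((n * n.+1) %/ 2)%N
       - (1 - q ^+ n) * \sum_(0 <= j < n.+1) q ^- ((j * j.+1) %/ 2)%N) in
  [/\ {in [:: q; a * b / q; a; b], forall x, cvgn (qpoch x q)},
      cvgn (series (phi32_term (q / a) (q / b) q sq (- sq) q (a * b / q))),
      cvgn (fun N => \sum_(1 <= n < N) t n)
    & qpochs_oo [:: q; a * b / q] q / qpochs_oo [:: a; b] q
      * phi32 (q / a) (q / b) q sq (- sq) q (a * b / q)
      = 1 + limn (fun N => \sum_(1 <= n < N) t n)].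
Proof.
move=> t; set z := a * b / q; set A := q / a; set B := q / b.
have [z1 a1 b1] : [/\ `|z| < 1, `|a| < 1 & `|b| < 1].
  (* The complex order is partial; the maximum splits because norms are real, hence comparable. *)
  have realn (x : Cplx R) : `|x| \is Num.real by apply: normr_real.
  move: ab_lt1; rewrite comparable_gt_max ?real_comparable ?max_real //.
  by rewrite comparable_gt_max ?real_comparable // => /and3P[].
have ABz : A * B * z = q by rewrite /A /B /z; field; rewrite q_neq0 a_neq0 b_neq0.
have Bz : B * z = a by rewrite /B /z; field; rewrite q_neq0 b_neq0.
have Az : A * z = b by rewrite /A /z; field; rewrite q_neq0 a_neq0.
have abE : a * b = z * q by rewrite /z divfK.
clearbody z.
have s1 : `|sq| < 1 by rewrite -(expr_lt1 (n := 2)) // -normrX sq2.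
have Ns1 : `|- sq| < 1 by rewrite normrN.
have nroot := q_nroot_lt1 q_lt1.
have nz x (x1 : `|x| < 1) k : 1 - x * q ^+ k != 0 := qfactor_neq0 q_lt1 k x1.
have p0 x (x1 : `|x| < 1) n : qpoch x q n != 0 := qpoch_neq0 n (nz x x1).
have [Ms Ms0 bs] := qpochV_bounded q_lt1 s1.
have [Ms' Ms'0 bs'] := qpochV_bounded q_lt1 Ns1.
pose v n := (qpoch sq q n * qpoch (- sq) q n)^-1.
have v_le n : `|v n| <= Ms * Ms' by rewrite /v invfM normrM ler_pM.
have vE n : \sum_(r < n.+1) bailey_alpha q r
      / (qqpoch q (n - r) * qqpoch q (n + r)) = v n.
  (* Factorwise, (1 - sq q^k)(1 + sq q^k) = 1 - q^(2k+1). *)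
  rewrite bailey_pair // /v /qpoch -big_split /=; congr (_^-1).
  by apply: eq_bigr => k _; rewrite exprS -{1}sq2 -muln2 exprM; ring.
have := bailey_limit q_neq0 q_lt1 ABz z1 _ _
  (bailey_alpha_bounded q_neq0 q_lt1) v_le vE.
rewrite Az Bz => /(_ a1 b1)[phi [S [sphi sS phiS]]].
pose hR n := qpoch A q n * qpoch B q n * z ^+ n / (qpoch a q n * qpoch b q n)
  * bailey_alpha q n.
have hR0 : hR 0%N = 1 by rewrite /hR !qpoch0 expr0 /= !mulr1 divr1.
have tE n : t n.+1 = hR n.+1.
  (* The integer exponent n^2 - 2n is negative at n = 1; the q^n inside (-ab)^n = (-zq)^n raises it
     to n(n-1). *)
  have qE : q ^ (n.+1%:Z ^+ 2 - 2 * n.+1%:Z) * q ^+ n.+1 = q ^+ (n.+1 * n).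
    by rewrite !(exprnP q) -expfzDr //; congr (q ^ _); lia.
  rewrite /t /hR /bailey_alpha -/(tri_psum q n.+1) -/(tri n.+1) !qpochs2.
  by rewrite abE (exprNn (z * q)) exprMn -qE; ring.
(* The numerator parameter q cancels the (q; q)_n of the denominator. *)
have termE : phi32_term A B q sq (- sq) q z
    = (fun n => qpoch A q n * qpoch B q n * z ^+ n * v n).
  apply/funext => n; rewrite /phi32_term /qpochs !big_cons !big_nil /v; field.
  by rewrite !p0.
have tsum : (fun N => \sum_(1 <= n < N) t n) @ \oo --> (S - 1 : Cplx R).
  apply/cvgrPdist_lt => e e0; move/cvgrPdist_lt: sS => /(_ e e0) sS.
  (* The equality below needs N > 0: only then does [series hR N] contain the term [hR 0] = 1 that
     is removed. *)
  near=> N; have N0 : (0 < N)%N by near: N; apply: nbhs_infty_gt.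
  have -> : \sum_(1 <= n < N) t n = series hR N - 1.
    rewrite /series /= [in RHS]big_ltn // hR0 [1 + _]addrC addrK.
    by rewrite !big_nat; apply: eq_bigr => -[|n] //.
  by rewrite opprB addrA subrK; near: N.
have phiE : phi32 A B q sq (- sq) q z = phi.
  by rewrite /phi32 termE; exact: limn_eq sphi.
split.
- by move=> x _; apply/cvg_ex; exists (qpoch_oo x q); apply: qpoch_cvg.
- rewrite termE; apply/cvg_ex; exists phi; exact: sphi.
- apply/cvg_ex; exists (S - 1); exact: tsum.
rewrite phiE; apply: etrans (congr1 (+%R 1) (esym (limn_eq tsum))).
by rewrite !qpochs_oo2 phiS addrC subrK.
Unshelve. all: by end_near. Qed.
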